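(* Let $q$ be the cardinality of a finite field $\mathbf{F}$. For $a,b\in\mathbb{N}$ let $P_{a,b}(t)=Q_{a,b}(t,1)\in\mathbb{Z}[1/q][t]$, where $Q_{a,b}$ are the polynomials counting embeddings of alternating spaces defined in the context. Then $$P_{a,b}(t)=q^{-e}\,t^a\prod_{i=0}^{a+b-1}(t-q^{2i}),\qquad e=2\binom{a+b}{2}+a^2-\binom b2.$$
   Context: The polynomials $Q_{a,b}\in\mathbb{Z}[1/q][t,u]$, $a,b\in\mathbb{N}$, are determined by $Q_{0,0}=1$ and the (consistent) recurrences $$Q_{a,b}(t,u)=q^{-1}(t-1)tu^2\,Q_{a-1,b}(q^{-2}t,u)\quad(a\ge1),$$ $$Q_{a,b}(t,u)=q^{2a+b-1}(t-1)u\,Q_{a,b-1}(q^{-2}t,u)+q^{2a+b-1}(u-1)\,Q_{a,b-1}(t,q^{-1}u)\quad(b\ge1).$$ They satisfy: $Q_{a,b}(q^{2m},q^n)$ is the number of form-preserving injective linear maps $V_{a,b}\to V_{m,n}$, where $V_{m,n}$ is the $\mathbf{F}$-vector space of dimension $2m+n$ with alternating form equal to the orthogonal sum of a non-degenerate form on a $2m$-dimensional space and the zero form on an $n$-dimensional space. *)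

(* Defs.v *)
From HB Require Import structures.
From mathcomp Require Import all_boot all_order all_algebra.
From mathcomp Require Import ring.

Set Implicit Arguments.
Unset Strict Implicit.
Unset Printing Implicit Defensive.

Import Order.TTheory GRing.Theory Num.Theory.
Local Open Scope ring_scope.

(* The subring Z[1/q] of rat: the rationals whose denominator only has prime
   factors dividing q; see in_zinvP for the description as fractions n / q^k. *)
Definition in_zinv (q : nat) : {pred rat} :=
  fun x => \pi(q).-nat `|denq x|%N.

Lemma dvd_denq (x : rat) (d : nat) (n : int) :
  x * d%:R = n%:~R -> (`|denq x| %| d)%N.
Proof.
move=> xd.
have e : numq x * d%:Z = n * denq x.
  apply: (@intr_inj rat); rewrite !rmorphM /= -xd numqE -pmulrn; ring.
rewrite -(Gauss_dvdr _ (n := `|numq x|)) 1?coprime_sym ?coprime_num_den //.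
by rewrite -[d]/(`|d%:Z|%N) -abszM e abszM dvdn_mull.
Qed.

Lemma in_zinv_frac (q d : nat) (x : rat) (n : int) :
  \pi(q).-nat d -> x * d%:R = n%:~R -> x \in in_zinv q.
Proof. by move=> dq /dvd_denq /pnat_dvd; apply. Qed.

Lemma in_zinvP (q : nat) (x : rat) : (0 < q)%N ->
  reflect (exists n : int, exists k : nat, x = n%:~R / q%:R ^+ k)
          (x \in in_zinv q).
Proof.
move=> q0; have qn0 : q%:R != 0 :> rat by rewrite pnatr_eq0 -lt0n.
apply: (iffP idP) => [xq | [n [k ->]]]; last first.
  apply: (@in_zinv_frac q (q ^ k) _ n); last by rewrite natrX divfK ?expf_neq0.
  by rewrite pnatX pnat_pi.
have d0 : (0 < `|denq x|)%N by rewrite absz_gt0 denq_neq0.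
have /dvdnP[c ec] : (`|denq x| %| q ^ `|denq x|)%N.
  apply/(dvdn_partP _ d0) => p; rewrite mem_primes => /and3P[pp _ pd].
  have pq : (p %| q)%N.
    have /pnatP -/(_ d0 p pp pd) := xq.
    by rewrite mem_primes => /and3P[].
  rewrite p_part; apply: dvdn_trans (dvdn_exp2r _ pq).
  by apply: dvdn_exp2l; rewrite ltnW // ltn_logl.
exists (numq x * c%:Z), `|denq x|%N.
have -> : q%:R ^+ `|denq x| = c%:R * (denq x)%:~R :> rat.
  by rewrite -natrX ec natrM -absz_denq.
have c0 : c%:R != 0 :> rat.
  apply: contraTneq q0 => /eqP; rewrite pnatr_eq0 => /eqP c0.
  by move: (expf_neq0 `|denq x| qn0); rewrite -natrX ec c0 mul0n eqxx.
rewrite rmorphM /= numqE -pmulrn.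
have dn0 : (denq x)%:~R != 0 :> rat by rewrite intr_eq0 denq_neq0.
by field; rewrite c0 dn0.
Qed.

Lemma mul_denq (x : rat) : x * `|denq x|%:R = (numq x)%:~R.
Proof. by rewrite numqE -[in RHS]absz_denq pmulrn. Qed.

Lemma in_zinv_subring (q : nat) : subring_closed (in_zinv q).
Proof.
split=> [|x y xq yq|x y xq yq]; first by [].
- apply: (@in_zinv_frac q (`|denq x| * `|denq y|) _
    (numq x * `|denq y|%:Z - numq y * `|denq x|%:Z)).
    by rewrite pnatM; apply/andP.
  rewrite rmorphB !rmorphM /= -!mul_denq ?natrM -!pmulrn; ring.
- apply: (@in_zinv_frac q (`|denq x| * `|denq y|) _ (numq x * numq y)).
    by rewrite pnatM; apply/andP.
  rewrite natrM intrM -!mul_denq; ring.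
Qed.

HB.instance Definition _ (q : nat) :=
  GRing.isSubringClosed.Build rat (in_zinv q) (in_zinv_subring q).

Record zinv (q : nat) := Zinv {zinv_val :> rat; _ : zinv_val \in in_zinv q}.

HB.instance Definition _ (q : nat) := [isSub for @zinv_val q].
HB.instance Definition _ (q : nat) := [Choice of zinv q by <:].
HB.instance Definition _ (q : nat) :=
  [SubChoice_isSubComNzRing of zinv q by <:].

Section ZinvUnit.
Variable q : nat.
Implicit Types x y : zinv q.

Definition zinv_unit : {pred zinv q} :=
  fun x => (val x != 0) && ((val x)^-1 \in in_zinv q).

Definition zinv_inv x : zinv q :=
  if x \in zinv_unit then insubd x (val x)^-1 else x.

Lemma zinv_mulVx : {in zinv_unit, left_inverse 1 zinv_inv *%R}.
Proof.
move=> x xu; have /andP[x0 xV] := xu; apply: val_inj.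
by rewrite rmorphM rmorph1 /zinv_inv xu /= [zinv_val _](insubdK x xV) mulVf.
Qed.

Lemma zinv_unitPl x y : y * x = 1 -> zinv_unit x.
Proof.
move=> /(congr1 val); rewrite rmorphM rmorph1 /= => yx.
have x0 : val x != 0.
  by apply: contra_eq_neq yx => ->; rewrite mulr0 eq_sym oner_neq0.
rewrite /zinv_unit x0 /=; suff -> : (val x)^-1 = val y by apply: valP.
by apply: (mulIf x0); rewrite mulVf.
Qed.

Lemma zinv_inv_out : {in [predC zinv_unit], zinv_inv =1 id}.
Proof. by move=> x xNu; rewrite /zinv_inv ifN. Qed.

End ZinvUnit.

HB.instance Definition _ (q : nat) :=
  GRing.ComNzRing_hasMulInverse.Build (zinv q)
    (@zinv_mulVx q) (@zinv_unitPl q) (@zinv_inv_out q).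

Lemma zinv_integral (q : nat) : GRing.integral_domain_axiom (zinv q).
Proof.
move=> x y /(congr1 val)/eqP; rewrite rmorphM rmorph0 mulf_eq0.
by rewrite -(inj_eq val_inj) -[y == 0](inj_eq val_inj) rmorph0.
Qed.

HB.instance Definition _ (q : nat) :=
  GRing.ComUnitRing_isIntegral.Build (zinv q) (@zinv_integral q).

Lemma zinv_natr_unit (q : nat) :
  (0 < q)%N -> (q%:R : zinv q) \is a GRing.unit.
Proof.
move=> q0; rewrite [_ \is a _]/(zinv_unit _) /zinv_unit rmorph_nat.
rewrite pnatr_eq0 -lt0n q0; apply/in_zinvP => //.
by exists 1, 1%N; rewrite expr1 mul1r.
Qed.

(* Bivariate polynomials R[t, u] are represented as R[t][u], that is, by
   {poly {poly R}} with u the outer and t the inner variable. *)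
Section Bivariate.
Variable R : comNzRingType.
Implicit Types (c x y : R) (p : {poly {poly R}}).

Definition tvar : {poly {poly R}} := 'X%:P.
Definition uvar : {poly {poly R}} := 'X.
Definition scal c : {poly {poly R}} := c%:P%:P.

(* p (c t, u) *)
Definition scale_t c p : {poly {poly R}} := map_poly (comp_poly (c *: 'X)) p.
(* p (t, c u) *)
Definition scale_u c p : {poly {poly R}} := p \Po (scal c * uvar).

Lemma scale_tE c p x y : (scale_t c p).[y%:P].[x] = p.[y%:P].[c * x].
Proof.
by rewrite -[y%:P](comp_polyC y (c *: 'X)) horner_map horner_comp !hornerE comp_polyC.
Qed.

Lemma scale_uE c p x y : (scale_u c p).[y%:P].[x] = p.[(c * y)%:P].[x].
Proof. by rewrite horner_comp !hornerE polyCM. Qed.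

End Bivariate.

(* The defining recurrences of Q; the second one is written at b + 1. *)
Definition embedding_recurrences (q : nat)
    (Q : nat -> nat -> {poly {poly zinv q}}) : Prop :=
  let q_ : zinv q := q%:R in
  let t := tvar (zinv q) in
  let u := uvar (zinv q) in
  [/\ Q 0 0 = 1,
      forall a b, Q a.+1 b =
        scal q_^-1 * (t - 1) * t * u ^+ 2 * scale_t (q_ ^- 2) (Q a b)
    & forall a b, Q a b.+1 =
        scal (q_ ^+ (2 * a + b)) * (t - 1) * u * scale_t (q_ ^- 2) (Q a b)
        + scal (q_ ^+ (2 * a + b)) * (u - 1) * scale_u q_^-1 (Q a b)].

(* Q_{a,0} is computed by the first recurrence, then Q_{a,b} by the second;
   Qpoly_recurrences shows that both recurrences hold for all a and b. *)
Fixpoint Qpoly (q a b : nat) : {poly {poly zinv q}} :=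
  let q_ : zinv q := q%:R in
  let t := tvar (zinv q) in
  let u := uvar (zinv q) in
  if b is b'.+1 then
    scal (q_ ^+ (2 * a + b')) * (t - 1) * u * scale_t (q_ ^- 2) (Qpoly q a b')
    + scal (q_ ^+ (2 * a + b')) * (u - 1) * scale_u q_^-1 (Qpoly q a b')
  else
    iter a (fun p => scal q_^-1 * (t - 1) * t * u ^+ 2 * scale_t (q_ ^- 2) p) 1.

Section Scale.
Variable R : comNzRingType.
Implicit Types (c d : R) (p r : {poly {poly R}}).

Lemma scale_tD c p r : scale_t c (p + r) = scale_t c p + scale_t c r.
Proof. exact: rmorphD. Qed.
Lemma scale_tB c p r : scale_t c (p - r) = scale_t c p - scale_t c r.
Proof. exact: rmorphB. Qed.
Lemma scale_tM c p r : scale_t c (p * r) = scale_t c p * scale_t c r.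
Proof. exact: rmorphM. Qed.
Lemma scale_t1 c : scale_t c 1 = 1.
Proof. exact: rmorph1. Qed.
Lemma scale_t_scal c d : scale_t c (scal d) = scal d.
Proof. by rewrite /scale_t /scal map_polyC /= comp_polyC. Qed.
Lemma scale_t_t c : scale_t c (tvar R) = scal c * tvar R.
Proof. by rewrite /scale_t /tvar /scal map_polyC /= comp_polyX -mul_polyC polyCM. Qed.
Lemma scale_t_u c : scale_t c (uvar R) = uvar R.
Proof. exact: map_polyX. Qed.

Lemma scale_uB c p r : scale_u c (p - r) = scale_u c p - scale_u c r.
Proof. exact: rmorphB. Qed.
Lemma scale_uM c p r : scale_u c (p * r) = scale_u c p * scale_u c r.
Proof. exact: rmorphM. Qed.
Lemma scale_u1 c : scale_u c 1 = 1.
Proof. exact: rmorph1. Qed.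
Lemma scale_u_scal c d : scale_u c (scal d) = scal d.
Proof. exact: comp_polyC. Qed.
Lemma scale_u_t c : scale_u c (tvar R) = tvar R.
Proof. exact: comp_polyC. Qed.
Lemma scale_u_u c : scale_u c (uvar R) = scal c * uvar R.
Proof. exact: comp_polyX. Qed.

Lemma scale_tu c d p : scale_u d (scale_t c p) = scale_t c (scale_u d p).
Proof.
rewrite /scale_u [in RHS]/scale_t map_comp_poly -/(scale_t c p).
by rewrite -/(scale_t c (scal d * uvar R)) scale_tM scale_t_scal scale_t_u.
Qed.

Lemma scalM c d : scal (c * d) = scal c * scal d.
Proof. by rewrite /scal !polyCM. Qed.
Lemma scal1 : scal 1 = 1 :> {poly {poly R}}.
Proof. by []. Qed.

End Scale.

Lemma Qpoly_recurrences (q : nat) : (0 < q)%N -> embedding_recurrences (Qpoly q).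
Proof.
move=> q0; split=> // a b; elim: b => [//|b IH].
have qu := zinv_natr_unit q0; set q_ : zinv q := q%:R in qu *.
rewrite [LHS]/= [Qpoly q a b.+1]/= -/q_ IH -/q_.
rewrite !(scale_tB, scale_tD, scale_uM, scale_tM, expr2, scale_uB, scale_u_scal,
  scale_t_scal, scale_u_t, scale_t_t, scale_u_u, scale_t_u, scale_u1, scale_t1).
rewrite -!expr2 scale_tu.
have -> : (2 * a.+1 + b = 2 + (2 * a + b))%N by rewrite mulnS addnA.
rewrite exprD !scalM -exprVn !expr2 !scalM !scal1.
have qq : scal q_ * scal q_^-1 = 1 :> {poly {poly zinv q}}.
  by rewrite -scalM mulrV // scal1.
set s := scal q_ in qq *; set s' := scal q_^-1 in qq *.
set w := scal (q_ ^+ _).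
move: (scale_t _ (scale_t _ _)) (scale_t _ (scale_u _ _)) => A B.
ring: qq.
Qed.

Lemma Qpoly_unique (q : nat) (Q' : nat -> nat -> {poly {poly zinv q}}) :
  embedding_recurrences Q' -> forall a b, Q' a b = Qpoly q a b.
Proof.
move=> [Q00 Qa Qb] a; elim=> [|b IH]; last by rewrite Qb IH.
by elim: a => [//|a IH]; rewrite Qa IH.
Qed.

(* P_{a,b}(t) = Q_{a,b}(t, 1) *)
Definition Ppoly (q a b : nat) : {poly zinv q} := (Qpoly q a b).[1].

Definition expo (a b : nat) : int :=
  2 * 'C(a + b, 2)%:Z + a%:Z ^+ 2 - 'C(b, 2)%:Z.

(* Main.v *)
Require Import Defs.
From mathcomp Require Import all_boot all_order all_algebra.
From mathcomp Require Import zify.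
Import GRing.Theory.
Local Open Scope ring_scope.

(** At [u = 1] the second term of the recurrence for [Q_{a,b+1}] vanishes, and
    both recurrences multiply [P(q^-2 t)] by [t - 1] times a monomial in [t].
    The substitution [t := q^-2 t] turns each root [q^(2i)] into [q^(2(i+1))],
    and the factor [t - 1] supplies the missing root [q^0]. *)

Lemma horner1_scale_t (R : comNzRingType) (c : R) (p : {poly {poly R}}) :
  (scale_t c p).[1] = p.[1] \Po (c *: 'X).
(* The point [1] is written as its own image under the substitution morphism, as [horner_map]
   requires. *)
Proof. by rewrite -[1 in LHS](rmorph1 (comp_poly (c *: 'X))) horner_map. Qed.

Lemma horner1_rec_a (R : comNzRingType) (c d : R) (p : {poly {poly R}}) :
  (scal c * (tvar R - 1) * tvar R * uvar R ^+ 2 * scale_t d p).[1] =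
  c *: (('X - 1) * 'X * (p.[1] \Po (d *: 'X))).
Proof.
rewrite 4!hornerM horner1_scale_t horner_exp hornerX expr1n mulr1.
by rewrite hornerD hornerN !hornerC -!mulrA mul_polyC.
Qed.

Lemma horner1_rec_b (R : comNzRingType) (c d e : R) (p : {poly {poly R}}) :
  (scal c * (tvar R - 1) * uvar R * scale_t d p
   + scal c * (uvar R - 1) * scale_u e p).[1] =
  c *: (('X - 1) * (p.[1] \Po (d *: 'X))).
Proof.
rewrite hornerD !hornerM horner1_scale_t !hornerD !hornerN !hornerC hornerX.
by rewrite subrr mulr0 mul0r addr0 mulr1 -mulrA mul_polyC.
Qed.

(** Each of the [n] factors yields one scalar [q ^- 2] when its root moves from index [i] to
    [i + 1]; ['X - 1] fills index [0]. *)
Lemma prod_geometric_roots_comp (R : comUnitRingType) (q : R) (n : nat) :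
  q \is a GRing.unit ->
  ('X - 1) * ((\prod_(0 <= i < n) ('X - (q ^+ (2 * i))%:P)) \Po (q ^- 2 *: 'X))
  = q ^- (2 * n) *: \prod_(0 <= i < n.+1) ('X - (q ^+ (2 * i))%:P).
Proof.
move=> qu; elim: n => [|n IH].
  by rewrite big_nil rmorph1 mulr1 big_nat1 muln0 expr0 invr1 scale1r polyC1.
rewrite big_nat_recr // rmorphM /= mulrA IH.
rewrite [in RHS]big_nat_recr //= comp_polyB comp_polyX comp_polyC.
have -> : q ^- 2 *: 'X - (q ^+ (2 * n))%:P
          = q ^- 2 *: ('X - (q ^+ (2 * n.+1))%:P).
  by rewrite scalerBr -!mul_polyC -polyCM mulnS exprD mulKr ?unitrX.
by rewrite -scalerAl -scalerAr scalerA -!exprVn -exprD addnC -mulnS.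
Qed.

(** The monomial ['X^a] contributes the further scalar [q ^- (2 * a)]. *)
Lemma monomial_prod_comp (R : comUnitRingType) (q : R) (a n : nat) :
  q \is a GRing.unit ->
  ('X - 1) * (('X^a * \prod_(0 <= i < n) ('X - (q ^+ (2 * i))%:P))
                \Po (q ^- 2 *: 'X))
  = q ^- (2 * (a + n)) *:
      ('X^a * \prod_(0 <= i < n.+1) ('X - (q ^+ (2 * i))%:P)).
Proof.
move=> qu; rewrite rmorphM /= comp_Xn_poly exprZn -scalerAl -scalerAr mulrCA.
rewrite prod_geometric_roots_comp // -scalerAr scalerA.
by rewrite -!exprVn -exprM -exprD mulnDr addnC.
Qed.

(** The summand [1] matches the prefactor [q^-1] of the recurrence; the next two match the scalars
    from ['X^a] and from the product. *)
Lemma expo_succ_a (a b : nat) :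
  expo a.+1 b = 1 + (2 * a)%:Z + (2 * (a + b))%:Z + expo a b.
Proof. by rewrite /expo addSn binS bin1; lia. Qed.

(** The prefactor [q ^ (2a + b)] cancels the [q ^ (-2a)] coming from ['X^a] and leaves the term
    [- b]. *)
Lemma expo_succ_b (a b : nat) :
  expo a b.+1 = (2 * (a + b))%:Z - b%:Z + expo a b.
Proof. by rewrite /expo addnS !binS !bin1; lia. Qed.

Section Recurrences.
Variables (q a b : nat).
Hypothesis q_gt0 : (0 < q)%N.
Let q_ : zinv q := q%:R.

Lemma Ppoly_succ_a :
  Ppoly q a.+1 b = q_^-1 *: (('X - 1) * 'X * (Ppoly q a b \Po (q_ ^- 2 *: 'X))).
Proof.
(* [Qpoly] unfolds along [a] only at [b = 0], so general [b] needs the proved recurrence. *)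
have [_ Qa _] := Qpoly_recurrences q_gt0.
by rewrite /Ppoly Qa horner1_rec_a.
Qed.

Lemma Ppoly_succ_b :
  Ppoly q a b.+1 =
    q_ ^+ (2 * a + b) *: (('X - 1) * (Ppoly q a b \Po (q_ ^- 2 *: 'X))).
Proof. exact: horner1_rec_b. Qed.

End Recurrences.

Theorem proposition8p3 (F : finFieldType) (a b : nat) :
  let q : zinv #|F| := #|F|%:R in
  Ppoly #|F| a b =
    (q ^ (- expo a b)) *:
      ('X^a * \prod_(0 <= i < a + b) ('X - (q ^+ (2 * i))%:P)).
Proof.
move=> q; have q0 : (0 < #|F|)%N by apply/card_gt0P; exists 0.
have qu : q \is a GRing.unit by apply: zinv_natr_unit.
(* The induction follows the recursion of [Qpoly]: first [a] at [b = 0], then [b] for fixed [a]. *)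
elim: b => [|b IHb]; first elim: a => [|a IHa].
- by rewrite /Ppoly /= hornerC big_nil mulr1 scale1r.
- rewrite Ppoly_succ_a // IHa -/q comp_polyZ -scalerAr scalerA mulrAC.
  rewrite monomial_prod_comp // -scalerAl scalerA [_ * 'X]mulrAC -exprSr addSn.
  (* Since [q] is a unit, all powers merge into one integer power, and only the exponents remain to
     be compared. *)
  congr (_ *: _); rewrite exprnN -exprN1 -!exprzDr //.
  by rewrite expo_succ_a; congr (_ ^ _); lia.
- rewrite Ppoly_succ_b // IHb -/q comp_polyZ -scalerAr monomial_prod_comp //.
  rewrite !scalerA addnS; congr (_ *: _).
  rewrite exprnP !exprnN -!exprzDr //.
  by rewrite expo_succ_b; congr (_ ^ _); lia.
Qed.
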